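(* Let $A$ be an infinite set of prisoners and $(K,+)$ an abelian group with $|K|\ge2$. Suppose there exists a $K^A$-parity function $\phi:K^A\to K$. Then for every visibility graph $V$ on $A$ and every inning function $I$ on $A$ with $IN\ge2$ such that the hat game $\mathcal{G}=(A,K,V,I)$ satisfies (S1) $|I_1|=1$, and (S2) for every $a\in A$, $V(a)\cup H(a)=A\setminus\{a\}$, there is a predictor for $\mathcal{G}$ under which, for every coloring $f\in K^A$, at most one prisoner guesses incorrectly.
   Context: For a set $X$ and abelian group $(G,+)$, a $G^X$-parity function is a map $\phi:G^X\to G$ such that for all $f\in G^X$, $x\in X$ and $g_1,g_2\in G$, $\phi(f[x\mapsto g_1])-\phi(f[x\mapsto g_2])=g_2-g_1$, where $f[x\mapsto g]$ is $f$ with its value at $x$ changed to $g$. A hat game $(A,K,V,I)$ consists of: a set $A$ of prisoners and a set $K$ of colors (with $|A|,|K|\ge2$); a visibility graph $V\subseteq A^2$ with no loops, where $(a,b)\in V$ means $a$ sees $b$'s hat, and $V(a)=\{b:(a,b)\in V\}$; and an inning function $I$, a surjection from $A$ onto $\{\beta:1\le\beta\le\alpha\}$ for some nonzero ordinal $\alpha$. Write $IN=\max\operatorname{ran}(I)$, $I_\beta=\{a:I(a)=\beta\}$, and $H(a)=\{b:I(b)<I(a)\}$. A coloring is $f\in K^A$. Strategies: for each $a$, a function $S_a:K^{H(a)}\times K^{V(a)}\to K$; guesses are defined by transfinite recursion on $I(a)$ as $\sigma_a(f)=S_a(h_a^f,f\restriction V(a))$ with $h_a^f=(\sigma_b(f))_{b\in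 H(a)}$. A predictor is $P:K^A\to K^A$ with $P(f)(a)=\sigma_a(f)$ for some family of strategies. Prisoner $a$ guesses incorrectly under $f$ if $P(f)(a)\ne f(a)$. *)

(* Defs.v *)
From Stdlib Require Export Wellfounded.
From mathcomp Require Export all_boot all_order all_algebra.
From mathcomp Require Export boolp classical_sets functions cardinality.

Set Implicit Arguments.
Unset Strict Implicit.
Unset Printing Implicit Defensive.

Import Order.TTheory GRing.Theory.

Local Open Scope classical_set_scope.
Local Open Scope ring_scope.

Section Parity.
Context {X : Type} {G : zmodType}.

Definition update (f : X -> G) (x : X) (g : G) : X -> G :=
  fun y => if `[< y = x >] then g else f y.

Definition parity_function (phi : (X -> G) -> G) : Prop :=
  forall (f : X -> G) (x : X) (g1 g2 : G),
    phi (update f x g1) - phi (update f x g2) = g2 - g1.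

End Parity.

(* Ordinals are represented as the elements of a type O that is itself a limit
   ordinal: a nonempty well-ordered set without a greatest element. The element
   b of O stands for the order type of {c | c < b}. Every ordinal alpha occurs
   in such an O, for instance alpha + omega, so quantifying over all limit
   ordinals O amounts to quantifying over all ordinals. *)
Section Ordinals.
Context {d : Order.disp_t} {O : bOrderType d}.

Definition limit_ordinal : Prop :=
  well_founded (fun b c : O => (b < c)%O) /\
  (forall b : O, exists c : O, (b < c)%O).

(* The least element above b, which exists when O is a limit ordinal; the
   default value of xget is then irrelevant. *)
Definition ord_succ (b : O) : O :=
  xget b [set c | (b < c)%O /\ forall e, (b < e)%O -> (c <= e)%O].

Lemma ord_succP (b : O) : limit_ordinal ->
  (b < ord_succ b)%O /\ forall e, (b < e)%O -> (ord_succ b <= e)%O.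
Proof.
move=> [wf lim]; have [c bc] := lim b.
suff [m mP] : exists m, [set c | (b < c)%O /\ forall e, (b < e)%O -> (c <= e)%O] m.
  exact: (xgetPex b (ex_intro _ m mP)).
elim/(well_founded_ind wf): c bc => c IH bc.
have [[e ec be]|nlt] := pselect (exists2 e, (e < c)%O & (b < e)%O).
  exact: IH ec be.
exists c; split=> // e be; rewrite leNgt; apply/negP => ec.
by apply: nlt; exists e.
Qed.

Definition ord_one : O := ord_succ Order.bottom.
Definition ord_two : O := ord_succ ord_one.

End Ordinals.
Arguments limit_ordinal {d} O.

Section HatGame.
Context {A K : Type} {d : Order.disp_t} {O : bOrderType d}.
Implicit Types (V : set (A * A)) (I : A -> O).

Definition visibility_graph V : Prop := forall a, ~ V (a, a).

Definition sees V (a : A) : set A := [set b | V (a, b)].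

Definition inning_function I : Prop :=
  exists alpha : O, alpha <> Order.bottom /\
    range I = [set beta | (ord_one <= beta)%O /\ (beta <= alpha)%O].

Definition is_last_inning I (m : O) : Prop :=
  range I m /\ forall beta, range I beta -> (beta <= m)%O.

Definition inning_class I (beta : O) : set A := [set a | I a = beta].

Definition hears I (a : A) : set A := [set b | (I b < I a)%O].

Definition strategy V I : Type :=
  forall a : A, (hears I a -> K) -> (sees V a -> K) -> K.

(* Transfinite recursion on I a: rec b _ is the guess of an earlier prisoner b. *)
Definition guess (wfO : limit_ordinal O) V I (S : strategy V I) (f : A -> K) :
    A -> K :=
  Fix (wf_inverse_image A O _ I (proj1 wfO)) (fun=> K)
    (fun a rec => S a (fun b : hears I a => rec (\val b) (set_valP b))
                      (fun b : sees V a => f (\val b))).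

Lemma guessE (wfO : limit_ordinal O) V I (S : strategy V I) (f : A -> K) a :
  guess wfO S f a =
  S a (fun b : hears I a => guess wfO S f (\val b))
      (fun b : sees V a => f (\val b)).
Proof.
rewrite /guess Fix_eq // => x g h gh.
by congr (S x _ _); apply: funext => b; apply: gh.
Qed.

Definition predictor (wfO : limit_ordinal O) V I (P : (A -> K) -> A -> K) :
    Prop :=
  exists S : strategy V I, forall f a, P f a = guess wfO S f a.

Definition incorrect (P : (A -> K) -> A -> K) (f : A -> K) : set A :=
  [set a | P f a <> f a].

End HatGame.

(* Main.v *)
(** Prisoner [a0] of the first inning sees everyone else and guesses the unique
    color which makes the coloring, changed at [a0] only, a zero of the parity
    function. Call [h] that modified coloring. By induction on innings, every
    later prisoner [a] knows [h] away from [a], from what [a] sees and from the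
    (correct) earlier guesses, so [h a], the true color of [a], is again the only
    value which gives parity zero. *)
Require Import Defs.

Import Order.TTheory GRing.Theory.

Local Open Scope classical_set_scope.
Local Open Scope ring_scope.

Section ParityFunction.
Context {X : Type} {G : zmodType} {phi : (X -> G) -> G}.
Context (phiP : parity_function phi).
Implicit Types (f : X -> G) (x : X).

Lemma update_id f x : update f x (f x) = f.
Proof. by apply: funext => y; rewrite /update; case: asboolP => // ->. Qed.

(** Passing from color 0 to [g] at [x] lowers [phi] by [g], so [g := phi (update f x 0)] brings it
    to 0. *)
Lemma parity_update_zero f x : phi (update f x (phi (update f x 0))) = 0.
Proof.
have /eqP := phiP f x (phi (update f x 0)) 0.
by rewrite sub0r subr_eq addNr => /eqP.
Qed.

Lemma parity_zero_recover f x : phi f = 0 -> phi (update f x 0) = f x.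
Proof. by move=> f0; have := phiP f x 0 (f x); rewrite update_id f0 !subr0. Qed.

End ParityFunction.

Section ParityStrategy.
Context {A : Type} {K : zmodType} {d : Order.disp_t} {O : bOrderType d}.
Context (V : set (A * A)) (I : A -> O) (phi : (A -> K) -> K).

(* What [a] can reconstruct of the coloring; guesses take precedence over seen
   hats, since a prisoner may both hear and see [a0]. *)
Definition reconstruct {a : A} (heard : hears I a -> K) (seen : sees V a -> K) :
    A -> K :=
  fun b => match pselect (hears I a b), pselect (sees V a b) with
           | left hb, _ => heard (SigSub (mem_set hb))
           | _, left vb => seen (SigSub (mem_set vb))
           | _, _ => 0
           end.

(** One rule serves both roles: it gives [a0] the color that makes the parity 0, and every later
    prisoner the color that keeps it 0. *)
Definition parity_strategy : @strategy A K d O V I :=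
  fun a heard seen => phi (reconstruct heard seen).

(** The update at [a] is the default 0 of [reconstruct]: [a] neither hears nor sees itself, and
    every other prisoner is heard or seen. *)
Lemma parity_guessE (wfO : limit_ordinal O) (f : A -> K) (a : A) :
    visibility_graph V ->
    sees V a `|` hears I a = [set: A] `\` [set a] ->
  guess wfO parity_strategy f a =
  phi (update (fun b => if (I b < I a)%O then guess wfO parity_strategy f b
                        else f b) a 0).
Proof.
move=> graphV S2; rewrite guessE; congr phi; apply: funext => b.
rewrite /reconstruct /update; case: asboolP => [-> | neq_ba].
  case: pselect => [|_]; first by rewrite /hears /= ltxx.
  by case: pselect => // va; case: (graphV a va).
case: pselect => [hb | nhb]; first by rewrite ifT.
rewrite ifF; last exact/negP.
case: pselect => // nvb.
by have [] : (sees V a `|` hears I a) b by rewrite S2; split.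
Qed.

End ParityStrategy.

Theorem theorem5p2 (A : Type) (K : zmodType)
    (infA : infinite_set [set: A])
    (cardK : exists k1 k2 : K, k1 <> k2)
    (parity : exists phi : (A -> K) -> K, parity_function phi)
    (d : Order.disp_t) (O : bOrderType d) (ordO : limit_ordinal O)
    (V : set (A * A)) (I : A -> O) (IN : O)
    (graphV : visibility_graph V)
    (inningI : inning_function I)
    (lastI : is_last_inning I IN)
    (IN_ge2 : (ord_two <= IN)%O)
    (S1 : exists a, inning_class I ord_one = [set a])
    (S2 : forall a, sees V a `|` hears I a = [set: A] `\` [set a]) :
  exists P : (A -> K) -> A -> K,
    predictor ordO V I P /\
    forall f : A -> K, is_subset1 (incorrect P f).
Proof.
have [phi phiP] := parity; have [a0 a0P] := S1; have [alpha [_ rangeI]] := inningI.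
have I_a0 : I a0 = ord_one by rewrite -[_ = _]/(inning_class I ord_one a0) a0P.
have I_ge a : (I a0 <= I a)%O.
  have : range I (I a) by exists a.
  by rewrite rangeI I_a0 => -[].
have I_gt a : a <> a0 -> (I a0 < I a)%O.
  move=> neq_a; rewrite lt_neqAle I_ge andbT; apply/eqP => eqI; apply: neq_a.
  by rewrite -[_ = _]/([set a0] a) -a0P /inning_class /= -eqI.
pose P := guess ordO (parity_strategy V I phi).
exists P; split=> [|f]; first by exists (parity_strategy V I phi).
pose h := update f a0 (P f a0).
have P_a0 : P f a0 = phi (update f a0 0).
  rewrite /P parity_guessE //; congr (phi (update _ _ _)).
  (* Nobody precedes [a0], so no heard guess replaces a value of [f]. *)
  by apply: funext => b; rewrite ltNge I_ge.
have h0 : phi h = 0 by rewrite /h P_a0 parity_update_zero.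
have correct a : a <> a0 -> P f a = f a.
  elim/(well_founded_ind (wf_inverse_image A O _ I (proj1 ordO))): a => a IH neq_a.
  have -> : f a = h a by rewrite /h /update; case: asboolP.
  (* As [phi h = 0], [h a] is also a value of [phi]; it remains to compare the two arguments away
     from [a]. *)
  rewrite -(parity_zero_recover phiP h a h0) /P parity_guessE //.
  congr phi; apply: funext => b; rewrite /update; case: asboolP => // neq_ba.
  (* At [a0], [h] holds the guess of [a0], right or wrong, and [a] has heard it. *)
  rewrite /h /update; case: asboolP => [-> | neq_b]; first by rewrite I_gt.
  by case: ifP => // lt_ba; apply: IH.
move=> a b wrong_a wrong_b.
have eq_a0 c : incorrect P f c -> c = a0.
  by move=> wrong_c; apply: contrapT => /correct.
by rewrite (eq_a0 a wrong_a) (eq_a0 b wrong_b).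
Qed.
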